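(* Let $P=\{p_1,\ldots,p_n\}$ and $Q=\{q_1,\ldots,q_n\}$ be sets of $n$ points in $\mathbb{R}^2$, with $p_i=(x_i,y_i)$ and $q_i=(x_i^\prime,y_i^\prime)$ in rectangular coordinates, $i=1,\ldots,n$, and let $W=\{w_1,\ldots,w_n\}$ be a set of $n$ nonnegative real numbers (weights). For a $2\times 2$ rotation matrix $U$ let $\Delta(P,Q,W,U)=\sum_{i=1}^n w_i\|Uq_i-p_i\|^2$. Let $$a=\sum_{i=1}^n w_i x^\prime_i x_i+\sum_{i=1}^n w_i y^\prime_i y_i,\qquad b=\sum_{i=1}^n w_i y^\prime_i x_i-\sum_{i=1}^n w_i x^\prime_i y_i.$$ If $a=b=0$, then $U=I$, the $2\times 2$ identity matrix, minimizes $\Delta(P,Q,W,U)$ over all $2\times 2$ rotation matrices $U$. Otherwise, with $c=\sqrt{a^2+b^2}$ and $$\hat U=\begin{pmatrix} a/c & b/c\\ -b/c & a/c\end{pmatrix},$$ $U=\hat U$ minimizes $\Delta(P,Q,W,U)$ over all $2\times 2$ rotation matrices $U$.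
   Context: A rotation matrix is a real orthogonal matrix of determinant one. $\|\cdot\|$ is the Euclidean norm, and points are treated as column vectors when multiplied by matrices. The points and weights are indexed lists $p_1,\ldots,p_n$, $q_1,\ldots,q_n$, $w_1,\ldots,w_n$. *)

(* Defs.v *)
From HB Require Import structures.
From mathcomp Require Import all_boot all_order all_algebra.
From mathcomp Require Import reals.
Set Implicit Arguments.
Unset Strict Implicit.
Unset Printing Implicit Defensive.
Import Order.TTheory GRing.Theory Num.Theory.
Local Open Scope ring_scope.

Definition rotation_matrix (R : realType) (d : nat) (U : 'M[R]_d) : Prop :=
  U^T *m U = 1%:M /\ \det U = 1.

(* The canonical norm of MathComp-Analysis on matrices is the sup norm, hence
   an explicit Euclidean norm. *)
Definition enorm (R : realType) (d : nat) (v : 'cV[R]_d) : R :=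
  Num.sqrt (\sum_(k < d) v k 0 ^+ 2).

Definition xc (R : realType) (v : 'cV[R]_2) : R := v 0 0.
Definition yc (R : realType) (v : 'cV[R]_2) : R := v 1 0.

Definition mx22 (R : realType) (m00 m01 m10 m11 : R) : 'M[R]_2 :=
  \matrix_(i < 2, j < 2)
    if i == 0 then (if j == 0 then m00 else m01)
    else (if j == 0 then m10 else m11).

(* Point sets and weights are indexed families, so repetitions are allowed. *)
Definition Delta (R : realType) (n : nat) (p q : 'I_n -> 'cV[R]_2)
    (w : 'I_n -> R) (U : 'M[R]_2) : R :=
  \sum_(i < n) w i * enorm (U *m q i - p i) ^+ 2.

Definition minimizes_over_rotations (R : realType) (d : nat)
    (f : 'M[R]_d -> R) (U0 : 'M[R]_d) : Prop :=
  rotation_matrix U0 /\ forall U : 'M[R]_d, rotation_matrix U -> f U0 <= f U.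

(* Main.v *)
Require Import Defs.
From HB Require Import structures.
From mathcomp Require Import all_boot all_order all_algebra.
From mathcomp Require Import reals.
From mathcomp Require Import ring lra.
Import Order.TTheory GRing.Theory Num.Theory.
Local Open Scope ring_scope.

(** A plane rotation is determined by its first row (u, v), a point of the unit
    circle, and it preserves lengths.  Expanding the squares therefore leaves,
    in [Delta], a quantity that does not depend on the rotation, minus
    2 (u a + v b) ([Delta_rotation]).  Minimizing [Delta] thus amounts to
    maximizing the scalar product of the unit vector (u, v) with (a, b).  By
    Cauchy-Schwarz ([dot_unit_le]) this product is at most c = |(a, b)|, and
    the bound is reached at (a/c, b/c) when (a, b) is nonzero; when (a, b) = 0
    the product vanishes, so that [Delta] is constant on the rotations. *)

Lemma det_2x2 (R : comPzRingType) (A : 'M[R]_2) :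
  \det A = A 0 0 * A 1 1 - A 0 1 * A 1 0.
Proof.
have lift01 : lift 0 0 = 1 :> 'I_2 by apply/val_inj.
have lift10 : lift 1 0 = 0 :> 'I_2 by apply/val_inj.
rewrite (expand_det_row _ 0) big_ord_recl big_ord1 /cofactor !det_mx11 !mxE /=.
by rewrite !lift01 !lift10 expr0 expr1; ring.
Qed.

Lemma mx22_rotation (R : realType) (u v : R) :
  u ^+ 2 + v ^+ 2 = 1 -> rotation_matrix (mx22 u v (- v) u).
Proof.
move=> uv1; split.
  apply/matrixP => i j; rewrite !mxE big_ord_recl big_ord1 !mxE.
  by case: i => [[|[|//]] ?]; case: j => [[|[|//]] ?] /=; lra.
by rewrite det_2x2 !mxE /=; lra.
Qed.

(** Entrywise, |U|^2 = 2 and det U = 1 give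
    (U_00 - U_11)^2 + (U_01 + U_10)^2 = |U|^2 - 2 det U = 0, which forces the
    second row to be the first one turned by a right angle. *)
Lemma rotation_mx22P (R : realType) (U : 'M[R]_2) :
  rotation_matrix U ->
  [/\ U 0 0 ^+ 2 + U 0 1 ^+ 2 = 1, U 1 0 = - U 0 1 & U 1 1 = U 0 0].
Proof.
case=> /matrixP UtU; rewrite det_2x2 => detU.
have := UtU 0 0; have := UtU 1 1.
rewrite !mxE !big_ord_recl !big_ord0 !mxE /=.
have -> : lift 0 0 = 1 :> 'I_2 by apply/val_inj.
rewrite !addr0 => col1 col0.
have : (U 0 0 - U 1 1) ^+ 2 + (U 0 1 + U 1 0) ^+ 2 = 0 by lra.
move/eqP; rewrite paddr_eq0 ?sqr_ge0 // !sqrf_eq0 => /andP[/eqP e1 /eqP e2].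
have e11 : U 1 1 = U 0 0 by lra.
have e10 : U 1 0 = - U 0 1 by lra.
by split=> //; rewrite e11 e10 in detU; lra.
Qed.

Lemma enorm2_sqr (R : realType) (v : 'cV[R]_2) :
  enorm v ^+ 2 = xc v ^+ 2 + yc v ^+ 2.
Proof.
have lift01 : lift 0 0 = 1 :> 'I_2 by apply/val_inj.
rewrite sqr_sqrtr; last by apply: sumr_ge0 => k _; apply: sqr_ge0.
by rewrite big_ord_recl big_ord1 lift01.
Qed.

Lemma sqr_enorm_rotation_sub (R : realType) (U : 'M[R]_2) (q p : 'cV[R]_2) :
  rotation_matrix U ->
  enorm (U *m q - p) ^+ 2 = enorm q ^+ 2 + enorm p ^+ 2
    - 2 * (U 0 0 * (xc q * xc p + yc q * yc p)
           + U 0 1 * (yc q * xc p - xc q * yc p)).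
Proof.
case/rotation_mx22P=> unit_row e10 e11.
have lift01 : lift 0 0 = 1 :> 'I_2 by apply/val_inj.
have xE : xc (U *m q - p) = U 0 0 * xc q + U 0 1 * yc q - xc p.
  by rewrite /xc /yc !mxE big_ord_recl big_ord1 lift01.
have yE : yc (U *m q - p) = - U 0 1 * xc q + U 0 0 * yc q - yc p.
  by rewrite /xc /yc !mxE big_ord_recl big_ord1 lift01 e10 e11.
have len_q : xc q ^+ 2 + yc q ^+ 2
    = (U 0 0 ^+ 2 + U 0 1 ^+ 2) * (xc q ^+ 2 + yc q ^+ 2).
  by rewrite unit_row mul1r.
by rewrite !enorm2_sqr xE yE len_q; ring.
Qed.

Lemma Delta_rotation (R : realType) (n : nat) (p q : 'I_n -> 'cV[R]_2)
    (w : 'I_n -> R) (U : 'M[R]_2) :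
  rotation_matrix U ->
  Delta p q w U
  = \sum_(i < n) w i * (enorm (q i) ^+ 2 + enorm (p i) ^+ 2)
    - 2 * (U 0 0 * (\sum_(i < n) w i * xc (q i) * xc (p i)
                    + \sum_(i < n) w i * yc (q i) * yc (p i))
           + U 0 1 * (\sum_(i < n) w i * yc (q i) * xc (p i)
                      - \sum_(i < n) w i * xc (q i) * yc (p i))).
Proof.
move=> rotU; rewrite -sumrB -big_split /= !mulr_sumr -big_split /=.
rewrite mulr_sumr -sumrB; apply: eq_bigr => i _.
by rewrite sqr_enorm_rotation_sub //; ring.
Qed.

Lemma dot_unit_le (R : realType) (u v a b : R) :
  u ^+ 2 + v ^+ 2 = 1 -> u * a + v * b <= Num.sqrt (a ^+ 2 + b ^+ 2).
Proof.
move=> uv1; apply: (le_trans (ler_norm _)); rewrite -sqrtr_sqr ler_wsqrtr //.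
(* Lagrange's identity *)
have -> : a ^+ 2 + b ^+ 2 = (u * a + v * b) ^+ 2 + (u * b - v * a) ^+ 2.
  by rewrite -[LHS]mul1r -uv1; ring.
by rewrite lerDl sqr_ge0.
Qed.

Theorem theorem2 (R : realType) (n : nat) (p q : 'I_n -> 'cV[R]_2)
    (w : 'I_n -> R) (w_ge0 : forall i : 'I_n, 0 <= w i) :
  let a := \sum_(i < n) w i * xc (q i) * xc (p i)
           + \sum_(i < n) w i * yc (q i) * yc (p i) in
  let b := \sum_(i < n) w i * yc (q i) * xc (p i)
           - \sum_(i < n) w i * xc (q i) * yc (p i) in
  (a = 0 /\ b = 0 -> minimizes_over_rotations (Delta p q w) 1%:M) /\
  (~ (a = 0 /\ b = 0) ->
   let c := Num.sqrt (a ^+ 2 + b ^+ 2) in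
   minimizes_over_rotations (Delta p q w)
     (mx22 (a / c) (b / c) (- b / c) (a / c))).
Proof.
move=> a b; split=> [[a0 b0]|ab_neq0 c].
  have rot1 : rotation_matrix (1%:M : 'M[R]_2).
    by split; rewrite ?det1 // trmx1 mul1mx.
  split=> // U rotU.
  by rewrite !Delta_rotation // -/a -/b a0 b0 !mulr0.
have ab_gt0 : 0 < a ^+ 2 + b ^+ 2.
  rewrite lt0r addr_ge0 ?sqr_ge0 // andbT paddr_eq0 ?sqr_ge0 // !sqrf_eq0.
  by apply/negP => /andP[/eqP a0 /eqP b0]; apply: ab_neq0.
have c_neq0 : c != 0 by rewrite gt_eqF // sqrtr_gt0.
have c2 : c ^+ 2 = a ^+ 2 + b ^+ 2 by rewrite sqr_sqrtr // ltW.
have rot_hat : rotation_matrix (mx22 (a / c) (b / c) (- b / c) (a / c)).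
  rewrite mulNr; apply: mx22_rotation.
  by rewrite !expr_div_n -mulrDl -c2 divff // expf_neq0.
split=> // U rotU; rewrite !Delta_rotation // -/a -/b !mxE /=.
have -> : a / c * a + b / c * b = c.
  by rewrite mulrAC [b / c * b]mulrAC -mulrDl -!expr2 -c2 expr2 mulfK.
have [unit_row _ _] := rotation_mx22P _ _ rotU.
by rewrite lerD2l lerN2 ler_pM2l // dot_unit_le.
Qed.
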